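(* Assume that Cauchy problems for the RBK system with initial data in $X_1^+$ have unique solutions. Let $c=(c_j)$ be a solution of the RBK system, let $P:=\{j\in\mathbb N: c_j(0)>0\}$, and let $\mathcal J(t):=\{j\in\mathbb N: c_j(t)>0\}$. If $\#P=1$, then $\mathcal J(t)=P$ for all $t>0$ in the interval of definition of $c$. (That is, a solution that starts monodisperse stays monodisperse for all later times.)
   Context: The rate coefficients $a_{j,k}$ ($j,k\in\mathbb N=\{1,2,\dots\}$) are real with $a_{j,k}=a_{k,j}\ge 0$. The Redner--Ben-Avraham--Kahng (RBK) system is $$\frac{dc_j}{dt}=\sum_{k=1}^\infty a_{j+k,k}c_{j+k}c_k-\sum_{k=1}^\infty a_{j,k}c_jc_k,\qquad j\in\mathbb N.$$ $X_1=\{x=(x_j)\in\mathbb R^{\mathbb N}: \|x\|_1:=\sum_{j=1}^\infty j|x_j|<\infty\}$ and $X_1^+=\{x\in X_1: x_j\ge 0\ \forall j\}$. Definition (solution). Let $T\in(0,+\infty]$. A (mild) solution of the RBK system on $[0,T)$ with $c(0)=c_0\in X_1^+$ is a function $c=(c_j):[0,T)\to X_1^+$ such that: (i) each $c_j:[0,T)\to[0,\infty)$ is continuous and $\sup_{t\in[0,T)}\|c(t)\|_1<\infty$; (ii) for all $j\in\mathbb N$ and $t\in[0,T)$, $\int_0^t\sum_{k=1}^\infty a_{j,k}c_k(s)\,ds<\infty$; (iii) for all $j\in\mathbb N$ and $t\in[0,T)$, $$c_j(t)=c_{0j}+\int_0^t\Big[\sum_{k=1}^\infty a_{j+k,k}c_{j+k}(s)c_k(s)-\sum_{k=1}^\infty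 a_{j,k}c_j(s)c_k(s)\Big]ds.$$ Uniqueness means: for every $T\in(0,+\infty]$, two solutions on $[0,T)$ with the same initial condition $c_0\in X_1^+$ coincide. *)

(* Defs.v *)
From HB Require Import structures.
From mathcomp Require Import all_boot all_order all_algebra.
From mathcomp Require Import all_classical all_reals all_analysis.
Set Implicit Arguments.
Unset Strict Implicit.
Unset Printing Implicit Defensive.
Import Order.TTheory GRing.Theory Num.Theory.
Import numFieldNormedType.Exports.
Local Open Scope classical_set_scope.
Local Open Scope ring_scope.

(* Sequences are indexed by {1, 2, ...}: they are functions on [nat] whose
   value at 0 is junk and is never referred to below. *)

Definition rate_coefficients (R : realType) (a : nat -> nat -> R) : Prop :=
  forall j k, (0 < j)%N -> (0 < k)%N -> a j k = a k j /\ 0 <= a j k.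

Definition norm1 (R : realType) (x : nat -> R) : \bar R :=
  (\sum_(1 <= j <oo) (j%:R * `|x j|)%:E)%E.

Definition X1 (R : realType) : set (nat -> R) :=
  [set x | (norm1 x < +oo)%E].

Definition X1pos (R : realType) : set (nat -> R) :=
  [set x | X1 x /\ forall j, (0 < j)%N -> 0 <= x j].

(* The interval [0, T), where T may be +oo. *)
Definition time_interval (R : realType) (T : \bar R) : set R :=
  [set t | 0 <= t /\ (t%:E < T)%E].

Definition gain (R : realType) (a : nat -> nat -> R) (x : nat -> R) (j : nat)
    : \bar R :=
  (\sum_(1 <= k <oo) (a (j + k)%N k * x (j + k)%N * x k)%:E)%E.

Definition loss (R : realType) (a : nat -> nat -> R) (x : nat -> R) (j : nat)
    : \bar R :=
  (\sum_(1 <= k <oo) (a j k * x j * x k)%:E)%E.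

(* The series have nonnegative terms and are summed in [0, +oo]. By [sol_fin]
   the loss term is integrable on [0, t], hence finite almost everywhere; so the
   integrand of [sol_mild] is a well-defined difference almost everywhere, and
   the equation in [\bar R], whose left-hand side is finite, forces the gain
   term to be integrable as well. *)
Record is_solution (R : realType) (a : nat -> nat -> R) (T : \bar R)
    (c0 : nat -> R) (c : R -> nat -> R) : Prop := IsSolution {
  sol_data : X1pos c0 ;
  sol_init : forall j, (0 < j)%N -> c 0 j = c0 j ;
  sol_X1pos : forall t, time_interval T t -> X1pos (c t) ;
  sol_cont : forall j, (0 < j)%N ->
    {within time_interval T, continuous (fun t => c t j)} ;
  sol_bounded :
    (ereal_sup [set norm1 (c t) | t in time_interval T] < +oo)%E ;
  sol_fin : forall j t, (0 < j)%N -> time_interval T t ->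
    (\int[lebesgue_measure]_(s in `[0%R, t])
       (\sum_(1 <= k <oo) (a j k * c s k)%:E) < +oo)%E ;
  sol_mild : forall j t, (0 < j)%N -> time_interval T t ->
    ((c t j)%:E = (c0 j)%:E +
       \int[lebesgue_measure]_(s in `[0%R, t])
         (gain a (c s) j - loss a (c s) j))%E
}.

Definition unique_solutions (R : realType) (a : nat -> nat -> R) : Prop :=
  forall (T : \bar R) (c0 : nat -> R) (c d : R -> nat -> R),
    (0 < T)%E -> X1pos c0 ->
    is_solution a T c0 c -> is_solution a T c0 d ->
    forall t j, time_interval T t -> (0 < j)%N -> c t j = d t j.

Definition positive_indices (R : realType) (x : nat -> R) : set nat :=
  [set j | (0 < j)%N /\ 0 < x j].

(* Main.v *)
(* Monodisperse data of size m produce nothing: the gain term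
   a_(j+k,k) c_(j+k) c_k of index j >= 1 would need j + k = k = m. The system
   therefore reduces to y' = - a_(m,m) y^2, whose explicit solution
   y(t) = lam / (1 + a_(m,m) lam t) is global and positive, and uniqueness
   identifies c with it. *)
Require Import Defs.
From mathcomp Require Import all_boot all_order all_algebra.
From mathcomp Require Import all_classical all_reals all_analysis.
From mathcomp Require Import ring.
Import Order.TTheory GRing.Theory Num.Theory.
Import numFieldNormedType.Exports.
Local Open Scope classical_set_scope.
Local Open Scope ring_scope.

Lemma eseries_single (R : realType) (f : nat -> \bar R) (m : nat) :
  (0 < m)%N -> (forall k, k <> m -> f k = 0%E) ->
  (\sum_(1 <= k <oo) f k)%E = f m.
Proof.
move=> m0 f0; apply: lim_near_cst => //.
(* The range [1 <= k < n] contains [m] exactly when [n] is at least [m.+1]; from there on the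
   partial sums equal [f m]. *)
exists m.+1 => // n /= mn.
rewrite (bigD1_seq m) ?iota_uniq ?mem_index_iota ?m0 ?mn//=.
by rewrite big1 ?adde0// => i /eqP /f0.
Qed.

Section Decay.
Context (R : realType) (b lam : R).
Hypotheses (b0 : 0 <= b) (lam0 : 0 <= lam).

Definition decay (t : R) : R := lam / (1 + b * lam * t).

Lemma decay_denom_gt0 t : 0 <= t -> 0 < 1 + b * lam * t.
Proof. by move=> t0; rewrite ltr_pwDl// !mulr_ge0. Qed.

Lemma decay_ge0 t : 0 <= t -> 0 <= decay t.
Proof. by move=> t0; rewrite divr_ge0// ltW// decay_denom_gt0. Qed.

Lemma decay_le t : 0 <= t -> decay t <= lam.
Proof.
move=> t0; rewrite ler_pdivrMr ?decay_denom_gt0//.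
by rewrite ler_peMr// lerDl !mulr_ge0.
Qed.

Lemma decay0 : decay 0 = lam.
Proof. by rewrite /decay mulr0 addr0 divr1. Qed.

(** The denominator is positive even at [t = 0], so the derivative is two-sided there and continuity
    on closed intervals follows pointwise. *)
Lemma is_derive_decay (t : R) : 0 <= t ->
  is_derive t 1 decay (- (b * decay t * decay t)).
Proof.
move=> t0; have /lt0r_neq0 d0 := decay_denom_gt0 _ t0.
rewrite /decay; apply: is_derive_eq.
by rewrite /GRing.scale/=; field.
Qed.

Lemma decay_continuous t : 0 <= t -> {for t, continuous decay}.
Proof.
move=> t0; have d := is_derive_decay _ t0.
exact/differentiable_continuous/derivable1_diffP/ex_derive.
Qed.

Lemma decay_sq_continuous t : 0 <= t ->
  {for t, continuous (fun s => - (b * decay s * decay s))}.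
Proof.
move=> t0; have ct := decay_continuous _ t0.
by apply: cvgN; apply: cvgM => //; apply: cvgM => //; exact: cvg_cst.
Qed.

Lemma integral_decay t : 0 <= t ->
  (\int[lebesgue_measure]_(s in `[0%R, t]) (- (b * decay s * decay s))%:E
   = (decay t - lam)%:E)%E.
Proof.
(* The fundamental theorem of calculus is applied on a nondegenerate interval, so [t = 0] is split
   off. *)
rewrite le_eqVlt => /predU1P[<-|t0].
  by rewrite set_itv1 integral_set1 decay0 subrr.
rewrite (@continuous_FTC2 _ _ decay)//.
- by rewrite decay0 EFinB.
- apply: continuous_in_subspaceT => s; rewrite inE/= in_itv/= => /andP[s0 _].
  exact: decay_sq_continuous.
- split.
  + move=> s; rewrite in_itv/= => /andP[/ltW s0 _].
    exact: (@ex_derive _ _ _ _ _ _ _ (is_derive_decay _ s0)).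
  + exact/cvg_at_right_filter/decay_continuous.
  + exact/cvg_at_left_filter/decay_continuous/ltW.
- move=> s; rewrite in_itv/= => /andP[/ltW s0 _].
  by rewrite derive1E; exact: (@derive_val _ _ _ _ _ _ _ (is_derive_decay _ s0)).
Qed.

End Decay.

(** Index 0 also receives the value 0 when [m] is positive, so [eseries_single], whose hypothesis
    ranges over all [k], applies. *)
Definition monodisperse (R : realType) (m : nat) (x : R) (j : nat) : R :=
  if j == m then x else 0.

Section Monodisperse.
Context (R : realType) (a : nat -> nat -> R) (m : nat).
Hypotheses (ha : rate_coefficients a) (m0 : (0 < m)%N).

Lemma norm1_monodisperse (x : R) :
  norm1 (monodisperse R m x) = (m%:R * `|x|)%:E.
Proof.
rewrite /norm1 (eseries_single _ _ _ m0) /monodisperse ?eqxx// => k /eqP.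
by move=> /negbTE ->; rewrite normr0 mulr0.
Qed.

Lemma X1pos_monodisperse (x : R) : 0 <= x -> X1pos (monodisperse R m x).
Proof.
move=> x0; split; first by rewrite /X1 /= norm1_monodisperse ltry.
by move=> j _; rewrite /monodisperse; case: ifP.
Qed.

Lemma gain_monodisperse (x : R) j : (0 < j)%N ->
  gain a (monodisperse R m x) j = 0%E.
Proof.
move=> j0; apply: eseries0 => k _ _; rewrite /monodisperse.
have [->|_] := eqVneq k m; last by rewrite mulr0.
(* For [k = m] the other factor sits at [j + m], and [j + m == m] reduces to [j == 0], which is
   false. *)
by rewrite -[X in _ == X]add0n eqn_add2r (gtn_eqF j0) mulr0 mul0r.
Qed.

Lemma loss_monodisperse (x : R) j :
  loss a (monodisperse R m x) j
  = (if j == m then a m m * x * x else 0)%:E.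
Proof.
rewrite /loss (eseries_single _ _ _ m0) /monodisperse ?eqxx.
  by case: eqP => [->|_]//; rewrite mulr0 mul0r.
by move=> k /eqP/negbTE ->; rewrite mulr0.
Qed.

Lemma monodisperse_solution (T : \bar R) (c0 : nat -> R) :
  (0 < T)%E -> X1pos c0 ->
  (forall j, (0 < j)%N -> j <> m -> c0 j = 0) ->
  is_solution a T c0 (fun t => monodisperse R m (decay R (a m m) (c0 m) t)).
Proof.
move=> T0 X0 c00; have [_ c0ge] := X0.
have lam0 : 0 <= c0 m by exact: c0ge.
have b0 : 0 <= a m m by have [] := ha m m m0 m0.
have c0E j : (0 < j)%N -> c0 j = monodisperse R m (c0 m) j.
  by move=> j0; rewrite /monodisperse; case: eqP => [->//|]; exact: c00.
split => //.
- by move=> j j0; rewrite decay0 (c0E j).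
- by move=> t [t0 _]; exact/X1pos_monodisperse/decay_ge0.
- move=> j j0; apply: continuous_in_subspaceT => t; rewrite inE => -[t0 _].
  rewrite /monodisperse; case: eqP => _; first exact: decay_continuous.
  exact: cvg_cst.
- apply: (@le_lt_trans _ _ (m%:R * c0 m)%:E); last exact: ltry.
  apply: ge_ereal_sup => _ [t [t0 _] <-].
  rewrite norm1_monodisperse lee_fin ler_wpM2l// ger0_norm ?decay_ge0//.
  exact: decay_le.
- move=> j t j0 [t0 _].
  (* Only [k = m] survives, for every [j]; what remains, [a j m] times [decay], is continuous on a
     compact interval, hence integrable. *)
  under eq_integral => s _.
    rewrite (eseries_single _ _ _ m0); last first.
      by move=> k /eqP/negbTE km; rewrite /monodisperse km mulr0.
    rewrite /monodisperse eqxx.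
    over.
  apply: integrable_lty => //.
  apply: (continuous_compact_integrable
    (f := fun s => a j m * decay R (a m m) (c0 m) s)).
    exact: segment_compact.
  apply: continuous_in_subspaceT => s; rewrite inE/= in_itv/= => /andP[s0 _].
  by apply: cvgM; [exact: cvg_cst|exact: decay_continuous].
- move=> j t j0 [t0 _].
  (* At [j = m] this leaves the integrand of [integral_decay]; at every other index both sides are
     0. *)
  under eq_integral do rewrite gain_monodisperse// loss_monodisperse// add0e.
  rewrite (c0E j j0) /monodisperse; case: eqP => _.
    by rewrite integral_decay// -EFinD addrC subrK.
  by rewrite oppe0 integral0 adde0.
Qed.

End Monodisperse.

Theorem proposition7p3 (R : realType) (a : nat -> nat -> R)
    (ha : rate_coefficients a) (huniq : unique_solutions a)
    (T : \bar R) (hT : (0 < T)%E) (c0 : nat -> R) (c : R -> nat -> R)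
    (hc : is_solution a T c0 c)
    (hP : (positive_indices (c 0) #= `I_1)%card) :
  forall t : R, time_interval T t -> 0 < t ->
    positive_indices (c t) = positive_indices (c 0).
Proof.
move=> t Tt t_gt0.
have hX := sol_data hc; have [_ c0ge] := hX.
(* Cardinality one yields a member [m] whose removal leaves the empty set. *)
have /eq_cardSP[m [m0 cm0]] := hP.
rewrite II0 card_eq0 => /eqP only_m.
have c00 j : (0 < j)%N -> j <> m -> c0 j = 0.
  (* A positive [c0 j] would put [j] in the set left after removing [m], which is empty. *)
  move=> j0 jm; apply/eqP; rewrite eq_le c0ge// andbT leNgt; apply/negP => cj.
  suff : (positive_indices (c 0) `\ m) j by rewrite only_m.
  by split => //; split => //; rewrite (sol_init hc).
have hd := monodisperse_solution R a m ha m0 T c0 hT hX c00.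
have lam0 : 0 < c0 m by rewrite -(sol_init hc).
have b0 : 0 <= a m m by have [] := ha m m m0 m0.
(* Strict positivity of the initial value keeps size [m] present at time [t]; this gives the
   inclusion of the initial support in the later one. *)
have decay_gt0 : 0 < decay R (a m m) (c0 m) t.
  by rewrite divr_gt0// decay_denom_gt0// ltW.
apply/seteqP; split => j [j0].
- rewrite (huniq T c0 _ _ hT hX hc hd t j Tt j0) /monodisperse.
  by case: eqP => [->|_]; rewrite ?ltxx.
- rewrite (sol_init hc)// => cj; split => //.
  rewrite (huniq T c0 _ _ hT hX hc hd t j Tt j0) /monodisperse.
  by case: eqP => // jm; move: cj; rewrite c00// ltxx.
Qed.
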